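(* Let $A$ be a ring and $S=A[\underline{t};\sigma,\underline{\delta}]$ a multivariate Ore extension in $n$ variables. Let $\underline{T}=(T_1,\dots,T_n)^t$ be a $(\sigma,\underline{\delta})$-pseudo-multilinear transformation (PMT) defined on a left $A$-module $V$. Then: (1) The map $\varphi:S\to \mathrm{End}(V,+)$ such that $\varphi(f(\underline{t}))=f(\underline{T})$ is a ring homomorphism. (2) There is a 1-1 correspondence between the set of $(\sigma,\underline{\delta})$-PMT's and the set of left $S$-modules.
   Context: All rings are associative with identity. Let $A$ be a ring, $n\ge 1$, $\sigma:A\to M_n(A)$ a ring homomorphism, and write $\sigma_{ij}(a)$ for the $(i,j)$ entry of $\sigma(a)$. Let $\underline{\delta}=(\delta_1,\dots,\delta_n)^t$ be a column of additive maps $A\to A$ forming a $\sigma$-derivation: $\delta_i(ab)=\sum_{j=1}^n\sigma_{ij}(a)\delta_j(b)+\delta_i(a)b$ for all $a,b\in A$, $1\le i\le n$. The multivariate Ore extension $S=A[\underline{t};\sigma,\underline{\delta}]$ is the ring of (finite) sums $\sum_{m\in M}\alpha_m m$, $\alpha_m\in A$, where $M$ is the free monoid on the variables $t_1,\dots,t_n$, with multiplication determined by concatenation in $M$ and the rules $t_ia=\sum_{j=1}^n\sigma_{ij}(a)t_j+\delta_i(a)$ for $a\in A$, $1\le i\le n$. A $(\sigma,\underline{\delta})$-pseudo-multilinear transformation (PMT) on a left $A$-module $V$ is a column $\underline{T}=(T_1,\dots,T_n)^t$ of elements of $\mathrm{End}(V,+)$ (additive endomorphisms of $V$) such that $T_i(a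 v)=\sum_{j=1}^n\sigma_{ij}(a)T_j(v)+\delta_i(a)v$ for all $a\in A$, $v\in V$, $1\le i\le n$. For $f(\underline{t})=\sum_m\alpha_m m\in S$, $f(\underline{T})\in\mathrm{End}(V,+)$ is obtained by replacing each $t_i$ by $T_i$ (words become compositions) and each coefficient $\alpha\in A$ by the left multiplication $L_\alpha:v\mapsto \alpha v$. *)

(* Defs.v *)
From HB Require Import structures.
From mathcomp Require Import all_boot all_algebra finmap.
From mathcomp Require Import boolp.
From mathcomp.multinomials Require Import monalg.

Set Implicit Arguments.
Unset Strict Implicit.
Unset Printing Implicit Defensive.

Import GRing.Theory.
Local Open Scope ring_scope.

(* The ring End(V,+): addition is pointwise, multiplication is composition,  *)
(* (f * g) v = f (g v).  Rings are pzRingType, i.e. the zero ring is allowed. *)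
Definition endo (V : zmodType) : Type := {additive V -> V}.

HB.instance Definition _ (V : zmodType) := gen_eqMixin (endo V).
HB.instance Definition _ (V : zmodType) := gen_choiceMixin (endo V).

Section Endo.
Variable V : zmodType.
Implicit Types f g h : endo V.

Lemma endoP f g : (forall v, f v = g v) -> f = g.
Proof.
case: f g => [f [[cf]]] [g [[cg]]] /= fg.
have {fg} fg : f = g by apply: funext.
by case: _ / fg cg => cg; rewrite (Prop_irrelevance cf cg).
Qed.

Definition endo_zero : endo V := \0.
Definition endo_opp f : endo V := \- f.
Definition endo_add f g : endo V := f \+ g.
Definition endo_one : endo V := idfun.
Definition endo_mul f g : endo V := f \o g.

Fact endo_addA : associative endo_add.
Proof. by move=> f g h; apply: endoP => v /=; rewrite addrA. Qed.
Fact endo_addC : commutative endo_add.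
Proof. by move=> f g; apply: endoP => v /=; rewrite addrC. Qed.
Fact endo_add0 : left_id endo_zero endo_add.
Proof. by move=> f; apply: endoP => v /=; rewrite add0r. Qed.
Fact endo_addN : left_inverse endo_zero endo_opp endo_add.
Proof. by move=> f; apply: endoP => v /=; rewrite addNr. Qed.

HB.instance Definition _ :=
  GRing.isZmodule.Build (endo V) endo_addA endo_addC endo_add0 endo_addN.

Fact endo_mulA : associative endo_mul.
Proof. by move=> f g h; apply: endoP. Qed.
Fact endo_mul1 : left_id endo_one endo_mul.
Proof. by move=> f; apply: endoP. Qed.
Fact endo_mulr1 : right_id endo_one endo_mul.
Proof. by move=> f; apply: endoP. Qed.
Fact endo_mulDl : left_distributive endo_mul endo_add.
Proof. by move=> f g h; apply: endoP. Qed.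
Fact endo_mulDr : right_distributive endo_mul endo_add.
Proof. by move=> f g h; apply: endoP => v /=; rewrite raddfD. Qed.

HB.instance Definition _ := GRing.Zmodule_isPzRing.Build (endo V)
  endo_mulA endo_mul1 endo_mulr1 endo_mulDl endo_mulDr.

Lemma endo0E v : (0 : endo V) v = 0. Proof. by []. Qed.
Lemma endo1E v : (1 : endo V) v = v. Proof. by []. Qed.
Lemma endoDE f g v : (f + g) v = f v + g v. Proof. by []. Qed.
Lemma endoNE f v : (- f) v = - f v. Proof. by []. Qed.
Lemma endoME f g v : (f * g) v = f (g v). Proof. by []. Qed.
Lemma endo_sumE (I : Type) (r : seq I) (P : pred I) (F : I -> endo V) v :
  (\sum_(i <- r | P i) F i) v = \sum_(i <- r | P i) F i v.
Proof. by elim/big_rec2: _ => // i y g _ <-. Qed.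

End Endo.

Definition lmul (A : pzRingType) (V : lmodType A) (a : A) : endo V := *:%R a.

Record sderivation (A : pzRingType) (n : nat) (sigma : {rmorphism A -> 'M[A]_n})
  := SDerivation {
  sder :> 'I_n -> endo A;
  sderM : forall (i : 'I_n) (a b : A),
    sder i (a * b) = (\sum_(j < n) sigma a i j * sder j b) + sder i a * b }.

Record pmt (A : pzRingType) (n : nat) (sigma : {rmorphism A -> 'M[A]_n})
    (delta : sderivation sigma) (V : lmodType A) := PMT {
  pmt_fun :> 'I_n -> endo V;
  pmtZ : forall (i : 'I_n) (a : A) (v : V),
    pmt_fun i (a *: v) =
      (\sum_(j < n) sigma a i j *: pmt_fun j v) + delta i a *: v }.

(* The carrier of the Ore extension A[t; sigma, delta]: finitely supported    *)
(* families of coefficients on the free monoid of words in t_1, ..., t_n;     *)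
(* the word t_i1 ... t_ik is the sequence [:: i1; ...; ik].                   *)
Definition ore (A : pzRingType) (n : nat) (sigma : {rmorphism A -> 'M[A]_n})
  (delta : sderivation sigma) : Type := {malg A[seq 'I_n]}.

Section MalgSum.
Variables (K : choiceType) (G W : zmodType) (h : K -> {additive G -> W}).

Definition malg_sum (g : {malg G[K]}) : W := \sum_(k <- msupp g) h k g@_k.

Lemma malg_sumEw (g : {malg G[K]}) (d : {fset K}) :
  (msupp g `<=` d)%fset -> malg_sum g = \sum_(k <- d) h k g@_k.
Proof.
move=> le_gd; rewrite /malg_sum; apply: big_fset_incl => //= k _ kg.
by rewrite mcoeff_outdom ?raddf0.
Qed.

Fact malg_sum_is_zmod_morphism : zmod_morphism malg_sum.
Proof.
move=> g1 g2; pose d := (msupp g1 `|` msupp g2)%fset.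
rewrite (@malg_sumEw (g1 - g2) d) ?msuppB_le //.
rewrite (@malg_sumEw g1 d) ?fsubsetUl // (@malg_sumEw g2 d) ?fsubsetUr //.
by rewrite -sumrB; apply: eq_bigr => k _; rewrite mcoeffB raddfB.
Qed.

HB.instance Definition _ :=
  GRing.isZmodMorphism.Build {malg G[K]} W malg_sum malg_sum_is_zmod_morphism.

Lemma malg_sumU k x : malg_sum << x *g k >> = h k x.
Proof.
by rewrite (@malg_sumEw _ [fset k]%fset) ?msuppU_le // big_seq_fset1 mcoeffUU.
Qed.

End MalgSum.

Section Ore.
Variables (A : pzRingType) (n : nat) (sigma : {rmorphism A -> 'M[A]_n}).
Variable delta : sderivation sigma.

Local Notation S := (ore delta).

HB.instance Definition _ := GRing.Zmodule.copy S {malg A[seq 'I_n]}.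

Definition ore_scale (a : A) (f : S) : S :=
  \sum_(w <- msupp f) << a * f@_w *g w >>.

Lemma ore_scaleE a f w : (ore_scale a f)@_w = a * f@_w.
Proof.
rewrite {2}[f]monalgE !raddf_sum mulr_sumr.
by apply/eq_bigr=> /= i _; rewrite !mcoeffU mulrnAr.
Qed.

Fact ore_scaleA a b f : ore_scale a (ore_scale b f) = ore_scale (a * b) f.
Proof. by apply/malgP=> w; rewrite !ore_scaleE mulrA. Qed.
Fact ore_scale1 : left_id 1 ore_scale.
Proof. by move=> f; apply/malgP=> w; rewrite !ore_scaleE mul1r. Qed.
Fact ore_scaleDr : right_distributive ore_scale +%R.
Proof.
by move=> a f g; apply/malgP=> w; rewrite !(mcoeffD, ore_scaleE) mulrDr.
Qed.
Fact ore_scaleDl f : {morph ore_scale^~ f : a b / a + b}.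
Proof. by move=> a b; apply/malgP=> w; rewrite !(mcoeffD, ore_scaleE) mulrDl. Qed.

HB.instance Definition _ := GRing.Zmodule_isLmodule.Build A S
  ore_scaleA ore_scale1 ore_scaleDr ore_scaleDl.

(* f(T) = \sum_w L_(f_w) T^w, where T^w is the composition T_i1 o ... o T_ik  *)
(* for w = [:: i1; ...; ik].                                                  *)
Definition ore_eval (V : lmodType A) (T : 'I_n -> endo V) (f : S) : endo V :=
  \sum_(w <- msupp f) lmul V f@_w * \prod_(i <- w) T i.

(* Left multiplication by t_i, as forced by the commutation rule:             *)
(* t_i (a w) = \sum_j sigma_ij(a) t_j w + delta_i(a) w.                       *)
Definition ore_act_fun (i : 'I_n) (f : S) : S :=
  \sum_(w <- msupp f)
    ((\sum_(j < n) << sigma f@_w i j *g j :: w >>) + << delta i f@_w *g w >>).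

Definition ore_act_coef i (w : seq 'I_n) (a : A) : S :=
  (\sum_(j < n) << sigma a i j *g j :: w >>) + << delta i a *g w >>.

Fact ore_act_coef_is_zmod_morphism i w : zmod_morphism (ore_act_coef i w).
Proof.
move=> a b; rewrite /ore_act_coef !raddfB /= opprD addrACA; congr (_ + _).
by rewrite -sumrB; apply: eq_bigr => j _; rewrite !mxE raddfB.
Qed.

HB.instance Definition _ i w := GRing.isZmodMorphism.Build A S
  (ore_act_coef i w) (ore_act_coef_is_zmod_morphism i w).

Fact ore_act_is_zmod_morphism i : zmod_morphism (ore_act_fun i).
Proof. exact: (malg_sum_is_zmod_morphism (ore_act_coef i)). Qed.

HB.instance Definition _ i := GRing.isZmodMorphism.Build S S
  (ore_act_fun i) (ore_act_is_zmod_morphism i).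

Definition ore_act (i : 'I_n) : endo S := ore_act_fun i.

(* f g = \sum_w f_w (w g), where the word w acts on g letter by letter. *)
Definition ore_mul (f g : S) : S := ore_eval ore_act f g.

Definition oreC (a : A) : S := << a *g [::] >>.
Definition oreM (w : seq 'I_n) : S := << 1 *g w >>.
Definition oreX (i : 'I_n) : S := oreM [:: i].

Lemma oreZU a b w : a *: (<< b *g w >> : S) = << a * b *g w >>.
Proof. by apply/malgP => u; rewrite ore_scaleE !mcoeffU mulrnAr. Qed.

Lemma ore_ind (P : S -> Prop) :
  P 0 -> (forall f g, P f -> P g -> P (f + g)) ->
  (forall a w, P << a *g w >>) -> forall f, P f.
Proof. by move=> P0 PD PU f; rewrite [f]monalgE; elim/big_ind: _. Qed.

Lemma ore_actU i a w : ore_act i << a *g w >> =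
  (\sum_(j < n) << sigma a i j *g j :: w >>) + << delta i a *g w >>.
Proof. exact: (malg_sumU (ore_act_coef i)). Qed.

Lemma ore_actZ i a f : ore_act i (a *: f) =
  (\sum_(j < n) sigma a i j *: ore_act j f) + delta i a *: f.
Proof.
elim/ore_ind: f => [|f g IHf IHg|b w].
- by rewrite !(scaler0, raddf0) addr0 big1 // => j _; rewrite raddf0 scaler0.
- rewrite !(scalerDr, raddfD) /= IHf IHg addrACA -big_split /=; congr (_ + _).
  by apply: eq_bigr => j _; rewrite raddfD scalerDr.
rewrite oreZU ore_actU sderM raddfD /= oreZU addrA; congr (_ + _).
under [in RHS]eq_bigr => j _ do rewrite ore_actU scalerDr scaler_sumr oreZU.
rewrite big_split /= exchange_big raddf_sum /=; congr (_ + _).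
apply: eq_bigr => j _; rewrite rmorphM mxE raddf_sum /=.
by apply: eq_bigr => k _; rewrite oreZU.
Qed.

Section Eval.
Variables (V : lmodType A) (T : 'I_n -> endo V).

Definition ore_eval_coef (w : seq 'I_n) (a : A) : endo V :=
  lmul V a * \prod_(i <- w) T i.

Fact ore_eval_coef_is_zmod_morphism w : zmod_morphism (ore_eval_coef w).
Proof. by move=> a b; apply: endoP => v; exact: scalerBl. Qed.

HB.instance Definition _ w := GRing.isZmodMorphism.Build A (endo V)
  (ore_eval_coef w) (ore_eval_coef_is_zmod_morphism w).

Lemma ore_eval_is_zmod_morphism : zmod_morphism (ore_eval T).
Proof. exact: (malg_sum_is_zmod_morphism ore_eval_coef). Qed.

Lemma ore_evalU a w : ore_eval T << a *g w >> = lmul V a * \prod_(i <- w) T i.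
Proof. exact: (malg_sumU ore_eval_coef). Qed.

End Eval.

Fact ore_mulDl : left_distributive ore_mul +%R.
Proof.
pose m := GRing.isZmodMorphism.Build S (endo S) _
  (@ore_eval_is_zmod_morphism S ore_act).
pose e : {additive S -> endo S} := HB.pack (ore_eval ore_act : S -> endo S) m.
by move=> f g h; exact: (congr1 (fun x : endo S => x h) (raddfD e f g)).
Qed.

Fact ore_mulDr : right_distributive ore_mul +%R.
Proof. by move=> f g h; rewrite /ore_mul raddfD. Qed.

Fact ore_mul0 g : ore_mul 0 g = 0.
Proof. by apply: (addIr (ore_mul 0 g)); rewrite -ore_mulDl !add0r. Qed.

Fact ore_mulr0 f : ore_mul f 0 = 0.
Proof. by rewrite /ore_mul raddf0. Qed.

Lemma ore_mulU a w g :
  ore_mul << a *g w >> g = a *: (\prod_(i <- w) ore_act i) g.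
Proof. by rewrite /ore_mul ore_evalU. Qed.

Fact ore_mulZ a f g : ore_mul (a *: f) g = a *: ore_mul f g.
Proof.
elim/ore_ind: f => [|f h IHf IHh|b w].
- by rewrite !(scaler0, ore_mul0).
- by rewrite scalerDr !ore_mulDl IHf IHh scalerDr.
by rewrite oreZU !ore_mulU scalerA.
Qed.

Fact ore_mul_act i f g : ore_mul (ore_act i f) g = ore_act i (ore_mul f g).
Proof.
elim/ore_ind: f => [|f h IHf IHh|b w].
- by rewrite !(raddf0, ore_mul0).
- by rewrite raddfD !ore_mulDl IHf IHh raddfD.
rewrite ore_actU ore_mulDl !ore_mulU ore_actZ; congr (_ + _).
rewrite (big_morph (ore_mul^~ g) (fun x y => ore_mulDl x y g) (ore_mul0 g)).
by apply: eq_bigr => j _; rewrite ore_mulU big_cons.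
Qed.

Fact ore_mulA : associative ore_mul.
Proof.
move=> f g h; elim/ore_ind: f => [|f f' IHf IHf'|a w].
- by rewrite !ore_mul0.
- by rewrite !ore_mulDl IHf IHf'.
rewrite !ore_mulU ore_mulZ; congr (_ *: _).
elim: w => [|i w IHw]; first by rewrite !big_nil.
by rewrite !big_cons !endoME ore_mul_act IHw.
Qed.

Fact ore_mul1 : left_id (oreC 1) ore_mul.
Proof. by move=> f; rewrite ore_mulU big_nil scale1r. Qed.

Lemma sder1 i : delta i 1 = 0.
Proof.
have := sderM delta i 1 1; rewrite mulr1 mulr1 rmorph1.
rewrite (bigD1 i) //= big1 => [|j ji]; last by rewrite mxE eq_sym (negPf ji) mul0r.
by rewrite mxE eqxx mul1r addr0 => /esym/eqP; rewrite -subr_eq0 addrK => /eqP.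
Qed.

Lemma ore_actM i w : ore_act i (oreM w) = oreM (i :: w).
Proof.
rewrite ore_actU sder1 raddf0 addr0 rmorph1 (bigD1 i) //= big1 => [|j ji].
  by rewrite mxE eqxx addr0.
by rewrite mxE eq_sym (negPf ji) raddf0.
Qed.

Lemma ore_wactM w w' : (\prod_(i <- w) ore_act i) (oreM w') = oreM (w ++ w').
Proof.
elim: w => [|i w IHw]; first by rewrite big_nil.
by rewrite big_cons endoME IHw ore_actM.
Qed.

Fact ore_mulr1 : right_id (oreC 1) ore_mul.
Proof.
move=> f; elim/ore_ind: f => [|f g IHf IHg|a w].
- by rewrite ore_mul0.
- by rewrite ore_mulDl IHf IHg.
by rewrite ore_mulU ore_wactM cats0 oreZU mulr1.
Qed.

HB.instance Definition _ := GRing.Zmodule_isPzRing.Build S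
  ore_mulA ore_mul1 ore_mulr1 ore_mulDl ore_mulDr.

(* A embeds in S as a subring, words multiply by concatenation, every f is    *)
(* \sum_w f_w w, and t_i a = \sum_j sigma_ij(a) t_j + delta_i(a): these       *)
(* facts, with freeness over the words, determine the ring S.                 *)

Fact oreC_is_zmod_morphism : zmod_morphism oreC.
Proof. by move=> a b; rewrite /oreC raddfB. Qed.

Fact oreC_is_monoid_morphism : monoid_morphism oreC.
Proof.
split=> // a b; rewrite [RHS]ore_mulU big_nil.
by rewrite /oreC oreZU.
Qed.

HB.instance Definition _ :=
  GRing.isZmodMorphism.Build A S oreC oreC_is_zmod_morphism.
HB.instance Definition _ :=
  GRing.isMonoidMorphism.Build A S oreC oreC_is_monoid_morphism.

Lemma oreM_cat w w' : oreM (w ++ w') = oreM w * oreM w'.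
Proof. by rewrite [RHS]ore_mulU scale1r ore_wactM. Qed.

Lemma oreCM a w : oreC a * oreM w = << a *g w >>.
Proof. by rewrite [LHS]ore_mulU big_nil oreZU mulr1. Qed.

Lemma oreE (f : S) : f = \sum_(w <- msupp f) oreC f@_w * oreM w.
Proof. by rewrite {1}[f]monalgE; apply: eq_bigr => w _; rewrite oreCM. Qed.

Lemma oreXC i a :
  oreX i * oreC a = (\sum_(j < n) oreC (sigma a i j) * oreX j) + oreC (delta i a).
Proof.
rewrite [LHS]ore_mulU scale1r big_seq1 ore_actU; congr (_ + _).
by apply: eq_bigr => j _; rewrite oreCM.
Qed.

End Ore.

(* The left R-module structures on a fixed abelian group V: the axioms are    *)
(* those of GRing.Zmodule_isLmodule.  Unlike lmodType R, this is a type whose *)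
(* Leibniz equality is equality of the scalar actions on the given V.         *)
Record lmodule_on (R : pzRingType) (V : zmodType) := LmoduleOn {
  lm_scale : R -> V -> V;
  lm_scaleA : forall a b v, lm_scale a (lm_scale b v) = lm_scale (a * b) v;
  lm_scale1 : left_id 1 lm_scale;
  lm_scaleDr : right_distributive lm_scale +%R;
  lm_scaleDl : forall v, {morph lm_scale^~ v : a b / a + b} }.

Definition lmodule_of (R : pzRingType) (V : zmodType) (m : lmodule_on R V) :
  Type := V.

Section LmoduleOf.
Variables (R : pzRingType) (V : zmodType) (m : lmodule_on R V).

HB.instance Definition _ := GRing.Zmodule.copy (lmodule_of m) V.
HB.instance Definition _ := GRing.Zmodule_isLmodule.Build R (lmodule_of m)
  (lm_scaleA m) (lm_scale1 m) (lm_scaleDr m) (lm_scaleDl m).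

End LmoduleOf.

(* A PMT carries with it the left A-module on which it is defined. *)
Record pmt_on (A : pzRingType) (n : nat) (sigma : {rmorphism A -> 'M[A]_n})
    (delta : sderivation sigma) (V : zmodType) := PMTOn {
  pmt_lmodule : lmodule_on A V;
  pmt_of :> pmt delta (lmodule_of pmt_lmodule : lmodType A) }.

(* Main.v *)
(* The words and A generate S, and T_i L_a = \sum_j L_(sigma_ij(a)) T_j +     *)
(* L_(delta_i(a)) in End(V,+), so evaluation at T intertwines left            *)
(* multiplication by t_i on S with T_i; multiplicativity follows by induction *)
(* on the left factor.  Conversely an S-module restricts to an A-module on    *)
(* which the action of the t_i is a PMT, and it is recovered from this data   *)
(* because every element of S is a sum of terms a w.                          *)

Require Import Defs.
From HB Require Import structures.
From mathcomp Require Import all_boot all_algebra.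
From mathcomp Require Import boolp.

Set Implicit Arguments.
Unset Strict Implicit.
Unset Printing Implicit Defensive.

Import GRing.Theory.
Local Open Scope ring_scope.

(** Multiplication in S is built from the operators [ore_act i], left multiplication by t_i. The PMT
    identity is the commutation rule of t_i with scalars read in End(V,+), so evaluation carries
    [ore_act i] to T_i ([ore_eval_act]); peeling letters off the left factor then gives [ore_evalM].
    Hence f.v = f(T)(v) is an S-action. Conversely, an S-action restricts to A and to the t_i; the
    relation [oreXC] makes this a PMT. Since A and the t_i generate S, the two passages are mutually
    inverse. *)

Section EvalMorphism.
Variables (A : pzRingType) (n : nat) (sigma : {rmorphism A -> 'M[A]_n}).
Variables (delta : sderivation sigma) (V : lmodType A) (T : pmt delta V).

Local Notation S := (ore delta).

HB.instance Definition _ := GRing.isZmodMorphism.Build S (endo V)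
  (ore_eval T) (@ore_eval_is_zmod_morphism _ _ _ delta V T).

Lemma ore_evalD (f g : S) : ore_eval T (f + g) = ore_eval T f + ore_eval T g.
Proof. exact: raddfD. Qed.

Lemma ore_eval0 : ore_eval T (0 : S) = 0.
Proof. exact: raddf0. Qed.

Lemma ore_evalC a v : ore_eval T (oreC delta a) v = a *: v.
Proof. by rewrite ore_evalU big_nil mulr1. Qed.

Lemma ore_evalX i v : ore_eval T (oreX delta i) v = T i v.
Proof. by rewrite ore_evalU big_seq1 endoME /= /lmul scale1r. Qed.

Lemma ore_evalZ a (f : S) v : ore_eval T (a *: f) v = a *: ore_eval T f v.
Proof.
elim/ore_ind: f => [|f g IHf IHg|b w].
- by rewrite scaler0 ore_eval0 endo0E scaler0.
- by rewrite scalerDr !ore_evalD !endoDE IHf IHg scalerDr.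
by rewrite oreZU !ore_evalU !endoME /= scalerA.
Qed.

(** This is where the PMT identity enters: on a monomial a w, the terms of [ore_actU] match those of
    [pmtZ] one by one. *)
Lemma ore_eval_act i (f : S) v :
  ore_eval T (ore_act delta i f) v = T i (ore_eval T f v).
Proof.
elim/ore_ind: f => [|f g IHf IHg|a w].
- by rewrite raddf0 ore_eval0 endo0E raddf0.
- by rewrite raddfD !ore_evalD !endoDE IHf IHg raddfD.
rewrite ore_actU ore_evalD raddf_sum endoDE endo_sumE !ore_evalU !endoME /=.
rewrite pmtZ; congr (_ + _); apply: eq_bigr => j _.
by rewrite ore_evalU big_cons.
Qed.

(** Additivity reduces the left factor to a monomial a w; the scalar comes out by [ore_evalZ], and
    the letters of w one at a time by [ore_eval_act]. *)
Lemma ore_evalM (f g : S) : ore_eval T (f * g) = ore_eval T f * ore_eval T g.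
Proof.
apply: endoP => v; rewrite endoME; elim/ore_ind: f => [|f h IHf IHh|a w].
- by rewrite mul0r ore_eval0.
- by rewrite mulrDl !ore_evalD !endoDE IHf IHh.
rewrite [_ * g]ore_mulU ore_evalZ ore_evalU endoME; congr (_ *: _).
elim: w => [|i w IHw]; first by rewrite !big_nil.
by rewrite !big_cons !endoME ore_eval_act IHw.
Qed.

Lemma ore_eval1 : ore_eval T (1 : S) = 1.
Proof. by apply: endoP => v; rewrite ore_evalC scale1r. Qed.

End EvalMorphism.

Lemma lmodule_onP (R : pzRingType) (V : zmodType) (m m' : lmodule_on R V) :
  (forall a v, lm_scale m a v = lm_scale m' a v) -> m = m'.
Proof.
case: m m' => [s sA s1 sr sl] [s' sA' s1' sr' sl'] /= ss'.
have {ss'} ss' : s = s' by apply: funext => a; apply: funext.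
by case: _ / ss' in sA' s1' sr' sl' *; congr LmoduleOn; apply: Prop_irrelevance.
Qed.

Section Correspondence.
Variables (A : pzRingType) (n : nat) (sigma : {rmorphism A -> 'M[A]_n}).
Variables (delta : sderivation sigma) (V : zmodType).

Local Notation S := (ore delta).

(** The type of the operators depends on the A-module structure, so the two structures are
    identified before the operators are compared. *)
Lemma pmt_onP (T T' : pmt_on delta V) :
    (forall a v, lm_scale (pmt_lmodule T) a v = lm_scale (pmt_lmodule T') a v) ->
    (forall i v, T i v = T' i v :> V) ->
  T = T'.
Proof.
case: T T' => [m T] [m' T'] /= /lmodule_onP mm'.
case: _ / mm' in T' *; case: T T' => [T TZ] [T' TZ'] /= TT'.
have {TT'} TT' : T = T' by apply: funext => i; apply: endoP.
by case: _ / TT' in TZ' *; rewrite (Prop_irrelevance TZ TZ').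
Qed.

Section PmtToModule.
Variable T : pmt_on delta V.

Definition pmt_scale (f : S) (v : V) : V := ore_eval T f v.

Fact pmt_scaleA f g v : pmt_scale f (pmt_scale g v) = pmt_scale (f * g) v.
Proof. by rewrite /pmt_scale ore_evalM. Qed.
Fact pmt_scale1 : left_id 1 pmt_scale.
Proof. by move=> v; rewrite /pmt_scale ore_eval1. Qed.
Fact pmt_scaleDr : right_distributive pmt_scale +%R.
Proof. by move=> f u v; exact: raddfD. Qed.
Fact pmt_scaleDl v : {morph pmt_scale^~ v : f g / f + g}.
Proof. by move=> f g; rewrite /pmt_scale ore_evalD. Qed.

Definition ore_module_of_pmt : lmodule_on S V :=
  LmoduleOn pmt_scaleA pmt_scale1 pmt_scaleDr pmt_scaleDl.

End PmtToModule.

Section ModuleToPmt.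
Variable m : lmodule_on S V.

(** Restriction of scalars along the embedding [oreC] of A into S. *)
Definition restr_scale (a : A) (v : V) : V := lm_scale m (oreC delta a) v.

Fact restr_scaleA a b v :
  restr_scale a (restr_scale b v) = restr_scale (a * b) v.
Proof. by rewrite /restr_scale lm_scaleA -rmorphM. Qed.
Fact restr_scale1 : left_id 1 restr_scale.
Proof. exact: lm_scale1. Qed.
Fact restr_scaleDr : right_distributive restr_scale +%R.
Proof. by move=> a; exact: lm_scaleDr. Qed.
Fact restr_scaleDl v : {morph restr_scale^~ v : a b / a + b}.
Proof. by move=> a b; rewrite /restr_scale raddfD lm_scaleDl. Qed.

Definition restr_lmodule : lmodule_on A V :=
  LmoduleOn restr_scaleA restr_scale1 restr_scaleDr restr_scaleDl.

Local Notation W := (lmodule_of restr_lmodule : lmodType A).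

Definition gen_act_fun (i : 'I_n) (v : W) : W := lm_scale m (oreX delta i) v.

Fact gen_act_is_zmod_morphism i : zmod_morphism (gen_act_fun i).
Proof. exact: (@scalerBr S (lmodule_of m) (oreX delta i)). Qed.

HB.instance Definition _ i := GRing.isZmodMorphism.Build W W
  (gen_act_fun i) (gen_act_is_zmod_morphism i).

Definition gen_act (i : 'I_n) : endo W := gen_act_fun i.

(** Both sides come from letting the identity [oreXC] of S act on v. *)
Fact gen_actZ i (a : A) (v : W) : gen_act i (a *: v) =
  (\sum_(j < n) sigma a i j *: gen_act j v) + delta i a *: v.
Proof.
have := congr1 (fun f : S => f *: (v : lmodule_of m)) (oreXC delta i a).
rewrite scalerDl scaler_suml -scalerA => /= H.
apply: etrans H _; congr (_ + _).
by apply: eq_bigr => j _; rewrite -scalerA.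
Qed.

Definition pmt_of_ore_module : pmt_on delta V :=
  @PMTOn _ _ _ delta V restr_lmodule (PMT gen_actZ).

(** Both sides are actions that are additive in f, so monomials suffice; there the module axioms
    split a w into its scalar and its letters. *)
Lemma pmt_of_ore_module_eval (f : S) (v : V) :
  ore_eval pmt_of_ore_module f v = lm_scale m f v.
Proof.
elim/ore_ind: f => [|f g IHf IHg|a w].
- rewrite ore_eval0; exact: esym (@scale0r S (lmodule_of m) v).
- by rewrite ore_evalD lm_scaleDl -IHf -IHg.
rewrite ore_evalU -oreCM -lm_scaleA; congr (lm_scale m _ _).
elim: w => [|i w IHw]; first by rewrite big_nil lm_scale1.
by rewrite big_cons endoME IHw -cat1s oreM_cat -lm_scaleA.
Qed.

End ModuleToPmt.

(** Evaluating at constants returns the scalar action, and at t_i the operator T_i. *)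
Lemma ore_module_of_pmtK : cancel ore_module_of_pmt pmt_of_ore_module.
Proof.
move=> T; apply: pmt_onP => [a v | i v].
  exact: (ore_evalC T a v).
exact: (ore_evalX T i v).
Qed.

Lemma pmt_of_ore_moduleK : cancel pmt_of_ore_module ore_module_of_pmt.
Proof. by move=> m; apply: lmodule_onP; exact: pmt_of_ore_module_eval. Qed.

End Correspondence.

Theorem proposition2p6 (A : pzRingType) (n : nat) (n_gt0 : (0 < n)%N)
    (sigma : {rmorphism A -> 'M[A]_n}) (delta : sderivation sigma) :
  (forall (V : lmodType A) (T : pmt delta V),
     zmod_morphism (ore_eval T : ore delta -> endo V) /\
     monoid_morphism (ore_eval T : ore delta -> endo V)) /\
  (forall V : zmodType,
     exists Phi : pmt_on delta V -> lmodule_on (ore delta) V,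
       bijective Phi /\
       forall (T : pmt_on delta V) (f : ore delta) (v : V),
         lm_scale (Phi T) f v = ore_eval T f v).
Proof.
split=> [V T|V].
  split; first exact: ore_eval_is_zmod_morphism.
  by split=> [|f g]; [exact: ore_eval1 | exact: ore_evalM].
exists (@ore_module_of_pmt _ _ _ delta V); split=> //.
exists (@pmt_of_ore_module _ _ _ delta V).
  exact: ore_module_of_pmtK.
exact: pmt_of_ore_moduleK.
Qed.
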